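(* Let $E$ be a Banach lattice. The following assertions are equivalent: (1) Each positive operator from $E$ into $\ell_1$ is uaw-Dunford–Pettis. (2) The norm of the dual Banach lattice $E'$ is order continuous.
   Context: All operators are continuous linear operators. A net $(x_\alpha)$ in a Banach lattice $E$ is uaw-convergent to $x$ (written $x_\alpha\xrightarrow{uaw}x$) if $|x_\alpha-x|\wedge u\to 0$ weakly for every $u\in E_+$. An operator $T$ from a Banach lattice $E$ into a Banach space $X$ is uaw-Dunford–Pettis if for every norm bounded sequence $(x_n)$ in $E$ with $x_n\xrightarrow{uaw}0$ one has $\|Tx_n\|\to 0$. *)

(* Defs.v *)
From HB Require Import structures.
From mathcomp Require Import all_boot all_order all_algebra.
From mathcomp Require Import all_classical all_reals all_analysis.
Set Implicit Arguments. Unset Strict Implicit. Unset Printing Implicit Defensive.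
Import Order.TTheory GRing.Theory Num.Theory.
Import numFieldNormedType.Exports.
Local Open Scope classical_set_scope.
Local Open Scope ring_scope.

Section BanachLattice.
Variables (R : realType) (E : completeNormedModType R).
Variables (le : E -> E -> Prop) (sup : E -> E -> E).

Definition labs (x : E) : E := sup x (- x).
Definition inf (x y : E) : E := - sup (- x) (- y).

Record banach_lattice : Prop := {
  bl_refl : forall x, le x x;
  bl_antisym : forall x y, le x y -> le y x -> x = y;
  bl_trans : forall x y z, le x y -> le y z -> le x z;
  bl_add : forall x y z, le x y -> le (x + z) (y + z);
  bl_scale : forall (a : R) x y, 0 <= a -> le x y -> le (a *: x) (a *: y);
  bl_supl : forall x y, le x (sup x y);
  bl_supr : forall x y, le y (sup x y);
  bl_suple : forall x y z, le x z -> le y z -> le (sup x y) z;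
  bl_norm : forall x y, le (labs x) (labs y) -> `|x| <= `|y| }.

Definition linear_fun (f : E -> R) :=
  forall (a : R) (x y : E), f (a *: x + y) = a * f x + f y.
Definition dual_elt (f : E -> R) := linear_fun f /\ continuous f.

Definition weak_cvg0 (x : nat -> E) :=
  forall f, dual_elt f -> (fun n => f (x n)) @ \oo --> (0 : R).

Definition uaw_cvg0 (x : nat -> E) :=
  forall u, le 0 u -> weak_cvg0 (fun n => inf (labs (x n - 0)) u).

Definition in_l1 (v : nat -> R) := cvgn (series (fun k => `|v k|)).
Definition l1norm (v : nat -> R) : R := limn (series (fun k => `|v k|)).

Definition l1_operator (T : E -> nat -> R) :=
  (forall x, in_l1 (T x)) /\
  (forall (a : R) x y, T (a *: x + y) = (fun k => a * T x k + T y k)) /\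
  (exists C : R, forall x, l1norm (T x) <= C * `|x|).

Definition positive_l1_operator (T : E -> nat -> R) :=
  l1_operator T /\ forall x, le 0 x -> forall k, 0 <= T x k.

Definition uaw_DP (T : E -> nat -> R) :=
  forall x : nat -> E, (exists M : R, forall n, `|x n| <= M) ->
    uaw_cvg0 x -> (fun n => l1norm (T (x n))) @ \oo --> (0 : R).

Definition dual_le (f g : E -> R) := forall x, le 0 x -> f x <= g x.

Definition dual_norm_order_continuous :=
  forall (I : Type) (leI : I -> I -> Prop) (f : I -> E -> R),
    (forall i, leI i i) -> (forall i j k, leI i j -> leI j k -> leI i k) ->
    (exists i : I, True) ->
    (forall i j, exists k, leI i k /\ leI j k) ->
    (forall i, dual_elt (f i)) ->
    (forall i j, leI i j -> dual_le (f j) (f i)) ->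
    (forall i, dual_le (fun _ => 0) (f i)) ->
    (forall g, dual_elt g -> (forall i, dual_le g (f i)) -> dual_le g (fun _ => 0)) ->
    forall eps : R, 0 < eps -> exists i0, forall i, leI i0 i ->
      forall x : E, `|x| <= 1 -> `|f i x| <= eps.

End BanachLattice.

(* Main.v *)
(** Both assertions are equivalent to (D): every positive functional of [E']
    tends to [0] along every norm bounded positive disjoint sequence of [E].

    A positive operator into l1 composed with the sum of coordinates is a
    positive functional computing the norm on the cone, so uaw-Dunford-Pettis
    only concerns positive functionals; since disjoint sequences are uaw-null,
    (1) implies (D).  If the norm of [E'] is order continuous and [v] is
    disjoint, the components of [phi] carried by the tails of [v] decrease to
    [0], hence in norm, and the [n]-th one agrees with [phi] at [v n]; this is
    (D).  Conversely, if (1) or (2) fails one builds positive [x k] on which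
    functionals below [phi] stay large while being small on
    [x k /\ 4^k (x 0 + ... + x (k-1))]; such a sequence is disjointified
    without losing these values, against (D). *)

Require Import Defs.
From HB Require Import structures.
From mathcomp Require Import all_boot all_order all_algebra.
From mathcomp Require Import all_classical all_reals all_analysis.
From mathcomp Require Import ring lra zify.
Set Implicit Arguments.
Unset Strict Implicit.
Unset Printing Implicit Defensive.
Import Order.TTheory GRing.Theory Num.Theory.
Import numFieldNormedType.Exports.
Local Open Scope ring_scope.

(** * Linear functionals: continuity and boundedness *)

Section LinearFunctionals.
Local Open Scope classical_set_scope.
Local Open Scope ring_scope.
Variables (R : realType) (E : completeNormedModType R) (f : E -> R).
Hypothesis lf : linear_fun f.

Lemma lin0 : f 0 = 0.
Proof. by have := lf 1 0 0; rewrite scale1r addr0 mul1r => h; lra. Qed.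

Lemma linD x y : f (x + y) = f x + f y.
Proof. by have := lf 1 x y; rewrite scale1r mul1r. Qed.

Lemma linZ a x : f (a *: x) = a * f x.
Proof. by have := lf a x 0; rewrite !addr0 lin0 addr0. Qed.

Lemma linN x : f (- x) = - f x.
Proof. by rewrite -scaleN1r linZ mulN1r. Qed.

Lemma linB x y : f (x - y) = f x - f y.
Proof. by rewrite linD linN. Qed.

Lemma lin_sum (I : Type) (r : seq I) (P : pred I) (F : I -> E) :
  f (\sum_(i <- r | P i) F i) = \sum_(i <- r | P i) f (F i).
Proof. exact: (big_morph f linD lin0). Qed.

Lemma dual_bounded : continuous f -> exists2 C, 0 <= C & forall x, `|f x| <= C * `|x|.
Proof.
move=> cf; have f0 : f x @[x --> (0 : E)] --> (0 : R) by rewrite -lin0; exact: cf.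
move/cvgr0Pnorm_lt: f0 => /(_ 1 ltr01)/nbhs_ballP[d /= d0 hd].
(* Rescaling a nonzero [x] to norm [d / 2] puts it in the ball of radius [d], where [f] stays below
   1 in absolute value; homogeneity then gives [2 / d]. *)
exists (2 / d) => [|x]; first by rewrite divr_ge0// ltW.
have [->|x0] := eqVneq x 0; first by rewrite lin0 !normr0 mulr0.
have nx : 0 < `|x| by rewrite normr_gt0.
have := hd ((d / 2 / `|x|) *: x); rewrite -ball_normE /= sub0r normrN normrZ.
rewrite ger0_norm ?divr_ge0 ?normr_ge0//; last by rewrite ltW.
rewrite divfK ?gt_eqF// => /(_ ltac:(lra)).
rewrite linZ normrM ger0_norm ?divr_ge0 ?normr_ge0//; last by rewrite ltW.
move=> /ltW h; rewrite -ler_pdivrMl ?divr_gt0//.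
rewrite -(ler_pM2l (x := `|x|^-1)) ?invr_gt0// mulVf ?gt_eqF//.
by apply: le_trans h; rewrite invf_div mulrA [_^-1 * _]mulrC.
Qed.

Lemma bounded_dual C : (forall x, `|f x| <= C * `|x|) -> dual_elt f.
Proof.
move=> fC; split=> // x; apply/cvgrPdist_lt => e e0.
(* The sign of [C] is unknown; this denominator is positive in any case. *)
have C1 : 0 < `|C| + 1 by have := normr_ge0 C; lra.
apply/nbhs_ballP; exists (e / (`|C| + 1)) => /=; first by rewrite divr_gt0.
move=> y; rewrite -ball_normE /= ltr_pdivlMr// => h.
rewrite -linB; apply: le_lt_trans (fC _) _; apply: le_lt_trans h.
rewrite mulrC ler_wpM2l ?normr_ge0//; have := ler_norm C; lra.
Qed.

End LinearFunctionals.

(** * Order, lattice operations and disjointness in a Banach lattice *)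

Section VectorLattice.
Local Open Scope classical_set_scope.
Local Open Scope ring_scope.
Variables (R : realType) (E : completeNormedModType R).
Variables (le : E -> E -> Prop) (join : E -> E -> E).
Hypothesis BL : banach_lattice le join.

Local Notation "x <=E y" := (le x y) (at level 70, y at next level).
Local Notation meet := (Defs.inf join).
Local Notation abs := (labs join).
Local Notation pos x := (join x 0).

Lemma leE_refl x : x <=E x.
Proof. exact: (bl_refl BL). Qed.
#[local] Hint Resolve leE_refl : core.

Lemma leE_trans y x z : x <=E y -> y <=E z -> x <=E z.
Proof. exact: (bl_trans BL). Qed.

Lemma leE_anti x y : x <=E y -> y <=E x -> x = y.
Proof. exact: (bl_antisym BL). Qed.

Lemma leE_add x y z t : x <=E y -> z <=E t -> x + z <=E y + t.
Proof.
move=> xy zt; apply: (@leE_trans (y + z)); first exact: (bl_add BL).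
by rewrite ![y + _]addrC; exact: (bl_add BL).
Qed.

Lemma bl_add_l x y z : y <=E z -> x + y <=E x + z.
Proof. exact/leE_add/leE_refl. Qed.

Lemma leE_subl x y z : x - z <=E y <-> x <=E y + z.
Proof.
by split=> /(bl_add BL) h; [move: (h z)|move: (h (- z))]; rewrite ?subrK ?addrK.
Qed.

Lemma leE_subr x y z : x <=E y - z <-> x + z <=E y.
Proof. by rewrite -leE_subl opprK. Qed.

Lemma subE_ge0 x y : 0 <=E y - x <-> x <=E y.
Proof.
by split=> /(bl_add BL) h; [move: (h x)|move: (h (- x))]; rewrite ?subrK ?add0r ?subrr.
Qed.

Lemma leE_opp x y : x <=E y -> - y <=E - x.
Proof. by move/subE_ge0 => h; apply/subE_ge0; rewrite opprK addrC. Qed.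

Lemma addE_ge0 x y : 0 <=E x -> 0 <=E y -> 0 <=E x + y.
Proof. by move=> hx hy; have := leE_add hx hy; rewrite addr0. Qed.

Lemma scaleE_ge0 (a : R) x : 0 <= a -> 0 <=E x -> 0 <=E a *: x.
Proof. by move=> a0 /(bl_scale BL a0); rewrite scaler0. Qed.

Lemma leE_scaler (a b : R) x : 0 <=E x -> a <= b -> a *: x <=E b *: x.
Proof.
by move=> x0 ab; apply/subE_ge0; rewrite -scalerBl; apply: scaleE_ge0; rewrite ?subr_ge0.
Qed.

Lemma leE_addl x y : 0 <=E y -> x <=E x + y.
Proof. by move=> y0; have := leE_add (leE_refl x) y0; rewrite addr0. Qed.

Lemma sumE_ge0 (I : Type) (r : seq I) (P : pred I) (F : I -> E) :
  (forall i, P i -> 0 <=E F i) -> 0 <=E \sum_(i <- r | P i) F i.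
Proof.
by move=> h; apply: big_ind => //; exact: addE_ge0.
Qed.

Lemma meetl x y : meet x y <=E x.
Proof. by rewrite -{2}(opprK x); apply: leE_opp; apply: (bl_supl BL). Qed.

Lemma meetr x y : meet x y <=E y.
Proof. by rewrite -{2}(opprK y); apply: leE_opp; apply: (bl_supr BL). Qed.

Lemma le_meet z x y : z <=E x -> z <=E y -> z <=E meet x y.
Proof.
by move=> zx zy; rewrite -(opprK z); apply: leE_opp; apply: (bl_suple BL); apply: leE_opp.
Qed.

Lemma meet_ge0 x y : 0 <=E x -> 0 <=E y -> 0 <=E meet x y.
Proof. exact: le_meet. Qed.

Lemma meet_mono x y z t : x <=E y -> z <=E t -> meet x z <=E meet y t.
Proof.
move=> xy zt; apply: le_meet.
- exact: leE_trans (meetl _ _) xy.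
- exact: leE_trans (meetr _ _) zt.
Qed.

Lemma meetC x y : meet x y = meet y x.
Proof. by apply: leE_anti; apply: le_meet; [exact: meetr|exact: meetl|exact: meetr|exact: meetl]. Qed.

(** Translations preserve meets, so a bound by [c + meet x w] splits into two plain inequalities;
    later meet estimates use this in place of a distributive law. *)
Lemma sub_meet_le z x w c : z - x <=E c -> z - w <=E c -> z <=E c + meet x w.
Proof.
move=> /leE_subl h1 /leE_subl h2; rewrite addrC; apply/leE_subl.
by apply: le_meet; apply/leE_subl; rewrite addrC.
Qed.

Lemma meet_subadd x y w : 0 <=E x -> 0 <=E y -> 0 <=E w ->
  meet (x + y) w <=E meet x w + meet y w.
Proof.
move=> x0 y0 w0; apply: sub_meet_le.
- apply: le_meet; apply/leE_subl; first exact: meetl.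
  by apply: leE_trans (meetr _ _) (leE_addl _ y0).
- apply: (@leE_trans 0); last exact: meet_ge0.
  by apply/leE_subl; rewrite add0r; exact: meetr.
Qed.

Lemma scale_meet (a : R) x y : 0 < a -> meet (a *: x) (a *: y) <=E a *: meet x y.
Proof.
move=> a0; have h z : z = a *: (a^-1 *: z) by rewrite scalerA divff ?scale1r ?gt_eqF.
rewrite [X in X <=E _]h; apply: (bl_scale BL); first exact: ltW.
have ai : 0 <= a^-1 by rewrite invr_ge0 ltW.
apply: le_meet.
- by have := bl_scale BL ai (meetl (a *: x) (a *: y)); rewrite [in X in _ <=E X]scalerA mulVf ?scale1r ?gt_eqF.
- by have := bl_scale BL ai (meetr (a *: x) (a *: y)); rewrite [in X in _ <=E X]scalerA mulVf ?scale1r ?gt_eqF.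
Qed.

Lemma le_abs x : x <=E abs x. Proof. exact: (bl_supl BL). Qed.
Lemma leN_abs x : - x <=E abs x. Proof. exact: (bl_supr BL). Qed.

Lemma abs_le x y : x <=E y -> - x <=E y -> abs x <=E y.
Proof. exact: (bl_suple BL). Qed.

Lemma abs_ge0 x : 0 <=E abs x.
Proof.
have := leE_add (le_abs x) (leN_abs x); rewrite subrr -mulr2n -scaler_nat => h.
have := @scaleE_ge0 (2^-1) _ _ h; rewrite scalerA mulVf ?scale1r ?pnatr_eq0//.
by apply; rewrite invr_ge0.
Qed.

Lemma ge0_abs x : 0 <=E x -> abs x = x.
Proof.
move=> x0; apply: leE_anti; last exact: le_abs.
apply: abs_le; first exact: leE_refl.
by apply: (leE_trans _ x0); rewrite -oppr0; exact: leE_opp.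
Qed.

Lemma abs_add x y : abs (x + y) <=E abs x + abs y.
Proof.
apply: abs_le; first by apply: leE_add; exact: le_abs.
by rewrite opprD; apply: leE_add; exact: leN_abs.
Qed.

Lemma norm_le_abs x y : abs x <=E y -> `|x| <= `|y|.
Proof.
move=> h; apply: (bl_norm BL); apply: leE_trans h _; exact: le_abs.
Qed.

Lemma norm_abs x : `|abs x| = `|x|.
Proof.
apply/eqP; rewrite eq_le; apply/andP; split; last exact: norm_le_abs.
by apply: (bl_norm BL); rewrite (ge0_abs (abs_ge0 x)).
Qed.

Lemma norm_mono x y : 0 <=E x -> x <=E y -> `|x| <= `|y|.
Proof. by move=> x0 xy; apply: norm_le_abs; rewrite ge0_abs. Qed.

Lemma pos_ge0 x : 0 <=E pos x. Proof. exact: (bl_supr BL). Qed.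
Lemma le_pos x : x <=E pos x. Proof. exact: (bl_supl BL). Qed.
Lemma pos_le x y : x <=E y -> 0 <=E y -> pos x <=E y.
Proof. exact: (bl_suple BL). Qed.
Lemma pos_mono x y : x <=E y -> pos x <=E pos y.
Proof. by move=> xy; apply: pos_le (pos_ge0 _); exact: leE_trans xy (le_pos y). Qed.

Lemma pos_neg x : x = pos x - pos (- x).
Proof.
apply: leE_anti.
  apply/leE_subr; rewrite addrC; apply/leE_subr; apply: pos_le.
    by rewrite addrC; apply: leE_addl; exact: pos_ge0.
  by apply/subE_ge0; exact: le_pos.
apply/leE_subl; apply: pos_le; first by apply: leE_addl; exact: pos_ge0.
by rewrite addrC -[X in _ + X]opprK; apply/subE_ge0; exact: le_pos.
Qed.

Lemma pos_meet_neg x : meet (pos x) (pos (- x)) <=E 0.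
Proof.
have -> : pos (- x) = pos x - x by apply/eqP; rewrite eq_sym subr_eq addrC -subr_eq -pos_neg.
set p := pos x; set m := meet _ _.
(* [p - m] dominates both [x] and 0, hence [pos x], which is [p] itself; this forces [m] below 0. *)
have : pos x <=E p - m.
  apply: pos_le; last by apply/subE_ge0; exact: meetl.
  rewrite -[X in X <=E _](subKr p); apply: bl_add_l; apply: leE_opp; exact: meetr.
by move=> /leE_opp h; have := leE_add h (leE_refl p); rewrite addNr opprB subrK.
Qed.

Lemma disj_meet_add x a b : 0 <=E x -> 0 <=E a -> 0 <=E b -> meet a b <=E 0 ->
  meet x a + meet x b <=E meet x (a + b).
Proof.
move=> x0 a0 b0 ab; apply: le_meet; last by apply: leE_add; exact: meetr.
set p := meet x a; set q := meet x b.
have pq : meet p q <=E 0 by apply: leE_trans ab; apply: meet_mono; exact: meetr.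
(* Both [p] and [q] lie below [x], so [p + q] is at most [x + meet p q], and disjointness of [a] and
   [b] removes the last term. *)
apply: (@leE_trans (x + meet p q)); last first.
  by rewrite -[X in _ <=E X]addr0; apply: leE_add.
by apply: sub_meet_le; [rewrite addrC addKr|rewrite addrK]; exact: meetl.
Qed.

Lemma disj_add a b c : 0 <=E a -> 0 <=E b -> 0 <=E c ->
  meet a c <=E 0 -> meet b c <=E 0 -> meet (a + b) c <=E 0.
Proof.
move=> a0 b0 c0 ac bc; apply: leE_trans (meet_subadd a0 b0 c0) _.
by rewrite -[X in _ <=E X](addr0 0); apply: leE_add.
Qed.

Lemma disj_sum (I : Type) (r : seq I) (P : pred I) (F : I -> E) c :
  0 <=E c -> (forall i, P i -> 0 <=E F i) -> (forall i, P i -> meet (F i) c <=E 0) ->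
  meet (\sum_(i <- r | P i) F i) c <=E 0.
Proof.
move=> c0 F0 Fc; elim: r => [|i r IH]; first by rewrite big_nil; exact: meetl.
rewrite big_cons; case: ifP => // Pi; apply: disj_add => //; [exact: F0|exact: sumE_ge0|exact: Fc].
Qed.


(** * Positive functionals and extension from the positive cone *)

Definition pos_lin (f : E -> R) := linear_fun f /\ forall x, 0 <=E x -> 0 <= f x.

Lemma pos_lin_mono f x y : pos_lin f -> x <=E y -> f x <= f y.
Proof. by move=> [lf f0] /subE_ge0 /f0; rewrite linB// subr_ge0. Qed.

Lemma pos_lin_abs f x : pos_lin f -> `|f x| <= f (abs x).
Proof.
move=> pf; have [lf _] := pf; rewrite ler_norml lerNl -linN//.
by apply/andP; split; apply: pos_lin_mono => //; [exact: leN_abs|exact: le_abs].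
Qed.

Lemma norm_pos x : `|pos x| <= `|x|.
Proof.
rewrite -(norm_abs x); apply: norm_mono; first exact: pos_ge0.
by apply: pos_le; [exact: le_abs|exact: abs_ge0].
Qed.

Section ConeExtension.
Variables (h phi : E -> R).
Hypothesis phi_dual : dual_elt phi.
Hypothesis h_bnd : forall x, 0 <=E x -> 0 <= h x <= phi x.
Hypothesis h_add : forall x y, 0 <=E x -> 0 <=E y -> h (x + y) = h x + h y.
Hypothesis h_scale : forall (a : R) x, 0 <= a -> 0 <=E x -> h (a *: x) = a * h x.

Let ext x := h (pos x) - h (pos (- x)).

(** Two differences of positive vectors that represent the same element have equal crossed sums, so
    additivity of [h] gives them the same value. *)
Let ext_split p q : 0 <=E p -> 0 <=E q -> ext (p - q) = h p - h q.
Proof.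
move=> p0 q0; rewrite /ext; set x := p - q.
have : pos x + q = pos (- x) + p.
  have /eqP := pos_neg x; rewrite -subr_eq opprK {1}/x => /eqP <-.
  by rewrite [RHS]addrC addrAC subrK.
move/(congr1 h); rewrite !h_add//; [lra|exact: pos_ge0..].
Qed.

(** Kantorovich's extension: linearity comes from [ext_split], and continuity from the domination of
    [h] by the bounded functional [phi] on the cone. *)
Lemma cone_extension : exists f, dual_elt f /\ forall x, 0 <=E x -> f x = h x.
Proof.
exists ext; split; last first.
  move=> x x0; have h0 : h 0 = 0 by rewrite -(scale0r x) h_scale// mul0r.
  by rewrite -{1}(subr0 x) ext_split// h0 subr0.
have [C C0 hC] := dual_bounded phi_dual.1 phi_dual.2.
apply: (@bounded_dual _ _ _ _ (2 * C)) => [a x y|x]; last first.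
  have hb z : 0 <= h (pos z) <= C * `|z|.
    have /andP[-> hz] /= := h_bnd (pos_ge0 z).
    apply: le_trans hz _; apply: le_trans (ler_norm _) _; apply: le_trans (hC _) _.
    by rewrite ler_wpM2l// norm_pos.
  have := hb (- x); have := hb x; rewrite /ext normrN ler_norml => /andP[? ?] /andP[? ?].
  by apply/andP; split; lra.
have p0 z := pos_ge0 z.
have [a0|a0] := leP 0 a.
  have -> : a *: x + y = (a *: pos x + pos y) - (a *: pos (- x) + pos (- y)).
    by rewrite opprD addrACA -scalerBr -!pos_neg.
  rewrite ext_split ?h_add ?h_scale//; try by [exact: scaleE_ge0|apply: addE_ge0 => //; exact: scaleE_ge0].
  by rewrite /ext; ring.
(* For negative [a] the positive and negative parts of [x] exchange roles. *)
have na0 : 0 <= - a by rewrite oppr_ge0 ltW.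
have -> : a *: x + y = ((- a) *: pos (- x) + pos y) - ((- a) *: pos x + pos (- y)).
  by rewrite opprD addrACA -scalerBr -pos_neg -opprB -pos_neg scaleNr scalerN opprK.
rewrite ext_split ?h_add ?h_scale//; try by [exact: scaleE_ge0|apply: addE_ge0 => //; exact: scaleE_ge0].
by rewrite /ext; ring.
Qed.

End ConeExtension.

(** * Norm limits and disjointification *)

Lemma lim_leE (u : nat -> E) (l z : E) :
  u @ \oo --> l -> (\forall n \near \oo, z <=E u n) -> z <=E l.
Proof.
move=> ul zu.
(* Once [z <=E u n], the vector [pos (z - l)] lies below [abs (u n - l)], whose norm is arbitrarily
   small. *)
have h : forall e : R, 0 < e -> `|pos (z - l)| <= e.
  move=> e e0; have /cvgrPdist_le/(_ _ e0) hd := ul.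
  near \oo => n.
  have : `|l - u n| <= e by near: n.
  apply: le_trans; rewrite distrC -(norm_abs (u n - l)); apply: norm_mono; first exact: pos_ge0.
  apply: pos_le; last exact: abs_ge0.
  apply: leE_trans (le_abs _); apply: (bl_add BL); near: n; exact: zu.
have /eqP : `|pos (z - l)| = 0.
  apply/eqP; rewrite eq_le normr_ge0 andbT; apply/ler_addgt0Pr => e e0.
  by rewrite add0r h.
rewrite normr_eq0 => /eqP p0.
by have := le_pos (z - l); rewrite p0 => /leE_subl; rewrite add0r.
Unshelve. all: by end_near. Qed.

(** By completeness the geometrically weighted series converges; its sum dominates each term because
    all terms are positive and the cone is closed. *)
Lemma weighted_bound (x : nat -> E) (M : R) :
  (forall k, 0 <=E x k) -> (forall k, `|x k| <= M) ->
  exists2 X, 0 <=E X & forall k, (2^-1 ^+ k) *: x k <=E X.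
Proof.
move=> x0 xM; pose y k : E := (2^-1 ^+ k) *: x k.
have h2 k : 0 <= (2^-1 : R) ^+ k by rewrite exprn_ge0// invr_ge0.
have y0 k : 0 <=E y k by exact: scaleE_ge0.
have M0 : 0 <= M by apply: le_trans (xM 0%N).
have cy : cvgn (series y).
  apply: normed_cvg.
  apply: (@series_le_cvg _ _ (geometric M 2^-1)) => [k|k|k|] /=.
  - exact: normr_ge0.
  - by rewrite mulr_ge0.
  - by rewrite /y normrZ ger0_norm// mulrC ler_wpM2r.
  - by apply: is_cvg_geometric_series; rewrite ger0_norm; lra.
exists (limn (series y)) => [|k].
  by apply: (lim_leE cy); near=> n; apply: sumE_ge0.
apply: (lim_leE cy); near=> n.
have kn : (k < n)%N by near: n; exact: nbhs_infty_gt.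
rewrite /series /= big_mkord (bigD1 (Ordinal kn))//=; apply: leE_addl.
exact: sumE_ge0.
Unshelve. all: by end_near. Qed.

Lemma pos_scale (a : R) x : 0 <= a -> pos (a *: x) <=E a *: pos x.
Proof.
move=> a0; apply: pos_le; first by apply: (bl_scale BL) => //; exact: le_pos.
by apply: scaleE_ge0 => //; exact: pos_ge0.
Qed.

Lemma pos_meet_scale (a : R) x : 0 < a -> meet (pos x) (a *: pos (- x)) <=E 0.
Proof.
(* [c] exceeds both 1 and [a], so both arguments can be enlarged to the same multiple and the scalar
   pulled out of the meet. *)
move=> a0; set c := a + 1.
have c0 : 0 < c by rewrite /c; lra.
have p0 z := pos_ge0 z.
apply: (@leE_trans (meet (c *: pos x) (c *: pos (- x)))).
  apply: meet_mono; last by apply: leE_scaler => //; rewrite /c; lra.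
  by rewrite -[X in X <=E _]scale1r; apply: leE_scaler => //; rewrite /c; lra.
apply: leE_trans (scale_meet _ _ c0) _.
by have := bl_scale BL (ltW c0) (pos_meet_neg x); rewrite scaler0.
Qed.

Lemma disjointify (x : nat -> E) (M : R) :
  (forall k, 0 <=E x k) -> (forall k, `|x k| <= M) ->
  exists (v : nat -> E) (X : E),
    [/\ 0 <=E X, forall k, 0 <=E v k, forall k, v k <=E x k,
        forall j k, (j < k)%N -> meet (v j) (v k) <=E 0 &
        forall k, x k <=E v k + meet (x k) ((4 ^+ k) *: \sum_(i < k) x i)
                       + (2^-1 ^+ k) *: X].
Proof.
move=> x0 xM; have [X X0 hX] := weighted_bound x0 xM.
have h2 k : 0 < (2^-1 : R) ^+ k by rewrite exprn_gt0// invr_gt0.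
have h4 k : 0 < (4 : R) ^+ k by rewrite exprn_gt0.
pose S k := \sum_(i < k) x i.
have S0 k : 0 <=E S k by exact: sumE_ge0.
have c0 k : 0 <=E 4 ^+ k *: S k by apply: scaleE_ge0 => //; exact: ltW.
have d0 k : 0 <=E 2^-1 ^+ k *: X by apply: scaleE_ge0 => //; exact: ltW.
(* For [j < k], [v j] and [v k] are dominated by multiples of the positive and
   negative parts of the single vector [x j - 2^-(j + k) x k]. *)
pose v k := pos (x k - (4 ^+ k *: S k + 2^-1 ^+ k *: X)).
have v0 k : 0 <=E v k by exact: pos_ge0.
exists v, X; split => // k.
- by apply: pos_le => //; apply/leE_subl; apply: leE_addl; exact: addE_ge0.
- move=> l kl; set a := x k - (2^-1 ^+ k * 2^-1 ^+ l) *: x l.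
  have vk : v k <=E pos a.
    apply: pos_mono; apply: bl_add_l; apply: leE_opp.
    rewrite -scalerA; apply: leE_trans (bl_scale BL (ltW (h2 k)) (hX l)) _.
    by rewrite addrC; exact: leE_addl.
  (* The vector [2 ^+ (k + l) *: (- a)] is [x l - 2 ^+ (k + l) *: x k]. Since [k < l], the
     coefficient is at most [4 ^+ l], and [x k] is a summand of [S l]: hence the weight [4 ^+ l] in
     [v l]. *)
  have vl : v l <=E 2 ^+ (k + l) *: pos (- a).
    apply: leE_trans (pos_scale _ _); last by rewrite exprn_ge0.
    apply: pos_mono; rewrite opprB scalerBr scalerA -exprD -exprMn mulfV ?pnatr_eq0// expr1n.
    rewrite scale1r; apply: bl_add_l; apply: leE_opp.
    apply: (@leE_trans (4 ^+ l *: S l)); last exact: leE_addl.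
    apply: (@leE_trans (4 ^+ l *: x k)).
      apply: leE_scaler => //; rewrite (_ : 4 = 2 ^+ 2 :> R); last by ring.
      by rewrite -exprM ler_weXn2l ?ler1n//; lia.
    apply: (bl_scale BL); first exact: ltW.
    by rewrite /S (bigD1 (Ordinal kl))//=; apply: leE_addl; exact: sumE_ge0.
  by apply: leE_trans (meet_mono vk vl) (pos_meet_scale _ _); rewrite exprn_gt0.
- rewrite -/(S k) addrAC; apply: sub_meet_le.
    by rewrite subrr; exact: addE_ge0.
  by apply/leE_subl; rewrite -addrA [X in v k + X]addrC; apply/leE_subl; exact: le_pos.
Qed.

(** * Condition (D) for a single functional, and vectors escaping every order bound *)

Definition disjoint_null (phi : E -> R) := forall (v : nat -> E) (M : R),
  (forall k, 0 <=E v k) -> (forall k, `|v k| <= M) ->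
  (forall j k, (j < k)%N -> meet (v j) (v k) <=E 0) ->
  phi (v n) @[n --> \oo] --> (0 : R).

(** Pairs are chosen recursively, [u] being [4 ^+ k] times the sum of the earlier vectors, and the
    vectors are then disjointified. This yields [e <= phi (v k) + e / 2 + 2^-1 ^+ k * phi X], whose
    outer terms tend to 0. *)
Lemma disjoint_null_escape (phi : E -> R) (M e : R) :
  0 < e -> disjoint_null phi ->
  ~ (forall u, 0 <=E u -> exists (g : E -> R) (x : E),
      [/\ pos_lin g, dual_le le g phi, 0 <=E x, `|x| <= M &
          e <= g x /\ g (meet x u) <= e / 2]).
Proof.
move=> e0 dn esc.
have esc' u : exists gx : (E -> R) * E, 0 <=E u ->
      [/\ pos_lin gx.1, dual_le le gx.1 phi, 0 <=E gx.2, `|gx.2| <= M &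
          e <= gx.1 gx.2 /\ gx.1 (meet gx.2 u) <= e / 2].
  (* Off the cone nothing is claimed, and a pair of zeros serves as default so that [choice]
     applies. *)
  have [u0|nu] := pselect (0 <=E u); last by exists (fun=> 0, 0).
  by have [g [x h]] := esc u u0; exists (g, x).
have [F hF] := choice esc'.
(* The recursion carries the partial sums, since each choice depends on the past only through its
   sum. *)
pose fix S k := if k is n.+1 then S n + (F (4 ^+ n *: S n)).2 else 0.
pose x k := (F (4 ^+ k *: S k)).2; pose g k := (F (4 ^+ k *: S k)).1.
have h4 k : 0 <= (4 : R) ^+ k by rewrite exprn_ge0.
have S0 k : 0 <=E S k.
  elim: k => [|k IH] //=; apply: addE_ge0 => //.
  by have [] := hF _ (scaleE_ge0 (h4 k) IH).
have hg k := hF _ (scaleE_ge0 (h4 k) (S0 k)).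
have SE k : S k = \sum_(i < k) x i.
  by elim: k => [|k IH]; rewrite ?big_ord0// big_ord_recr/= -IH.
have x0 k : 0 <=E x k by have [] := hg k.
have xM k : `|x k| <= M by have [] := hg k.
have [v [X [X0 v0 vx vd hx]]] := disjointify x0 xM.
have vM k : `|v k| <= M by apply: le_trans (xM k); exact: norm_mono.
have phiv := dn v M v0 vM vd.
have geo : (2^-1 : R) ^+ k * phi X @[k --> \oo] --> (0 : R).
  rewrite -(mul0r (phi X)); apply: cvgMr_tmp; apply: cvg_expr; rewrite ger0_norm; lra.
have e8 : 0 < e / 8 by lra.
near \oo => k.
have h1 : `|phi (v k)| <= e / 8 by near: k; exact: (cvgr0_norm_le _ phiv).
have h2 : `|2^-1 ^+ k * phi X| <= e / 8 by near: k; exact: (cvgr0_norm_le _ geo).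
have [pg gphi _ _ [h3 h4']] := hg k.
have lg := pg.1.
have := pos_lin_mono pg (hx k); rewrite !(linD lg) (linZ lg) -SE => h5.
have h6 := gphi _ (v0 k).
have h7 : 2^-1 ^+ k * g k X <= 2^-1 ^+ k * phi X.
  by apply: ler_wpM2l (gphi _ X0); rewrite exprn_ge0// invr_ge0.
move: h1 h2; rewrite !ler_norml => /andP[_ h1] /andP[_ h2].
rewrite -/(x k) -/(g k) in h3 h4' h5 h6; lra.
Unshelve. all: by end_near. Qed.

(** * Components of a functional and order continuity of the dual norm *)

Lemma subhomogeneous_eq (h : E -> R) :
  (forall (a : R) x, 0 <= a -> 0 <=E x -> h (a *: x) <= a * h x) ->
  (forall x, 0 <=E x -> 0 <= h x) ->
  forall (a : R) x, 0 <= a -> 0 <=E x -> h (a *: x) = a * h x.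
Proof.
move=> sub h0 a x; rewrite le_eqVlt => /predU1P[<- x0|a0 x0].
  apply/eqP; rewrite eq_le sub// mul0r h0// scale0r; exact: leE_refl.
apply/eqP; rewrite eq_le; apply/andP; split; first by apply: sub => //; exact: ltW.
rewrite -ler_pdivlMl//.
have := sub a^-1 (a *: x); rewrite scalerA mulVf ?gt_eqF// scale1r; apply.
  by rewrite invr_ge0 ltW.
by apply: scaleE_ge0 => //; exact: ltW.
Qed.

(* The functional obtained is the component of [phi] in the band generated by
   the [w m], given on the cone by [x |-> sup_m phi (x /\ w m)]. *)
Lemma component_functional (phi : E -> R) (w : nat -> E) :
  dual_elt phi -> pos_lin phi ->
  (forall m, 0 <=E w m) -> {homo w : m n / (m <= n)%N >-> m <=E n} ->
  (forall (c : R) m, 0 <= c -> exists n, c *: w m <=E w n) ->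
  exists f, [/\ dual_elt f,
    forall x m, 0 <=E x -> phi (meet x (w m)) <= f x &
    forall x c, 0 <=E x -> (forall m, phi (meet x (w m)) <= c) -> f x <= c].
Proof.
move=> dphi pphi w0 wm wc; have lphi := pphi.1.
have monophi := pos_lin_mono pphi.
pose h x := reals.sup [set phi (meet x (w m)) | m in [set: nat]].
have hle x m : 0 <=E x -> phi (meet x (w m)) <= h x.
  move=> x0; apply: ub_le_sup; last by exists m.
  by exists (phi x) => _ [n _ <-]; apply: monophi; exact: meetl.
have leh x c : (forall m, phi (meet x (w m)) <= c) -> h x <= c.
  by move=> hc; apply: ge_sup; [exists (phi (meet x (w 0%N))), 0%N|move=> _ [n _ <-]].
have h0 x : 0 <=E x -> 0 <= h x.
  move=> x0; apply: le_trans (hle x 0%N x0).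
  by apply: pphi.2; exact: meet_ge0.
have [f [df fh]] : exists f, dual_elt f /\ forall x, 0 <=E x -> f x = h x.
  apply: (@cone_extension h phi) => //.
  - move=> x x0; rewrite h0//=; apply: leh => m; apply: monophi; exact: meetl.
  - move=> x y x0 y0; apply/eqP; rewrite eq_le; apply/andP; split.
      apply: leh => m; apply: le_trans (lerD (hle x m x0) (hle y m y0)).
      by rewrite -linD//; apply: monophi; exact: meet_subadd.
    (* Superadditivity: the two suprema are handled one at a time with independent indices, and a
       later [w k] dominates twice the larger of [w m] and [w n]. *)
    rewrite -lerBrDr; apply: (leh) => m; rewrite lerBrDr -lerBrDl.
    apply: leh => n; rewrite lerBrDl -linD//.
    have [k hk] := wc 2 (maxn m n) (ler0n _ 2).
    apply: le_trans (hle (x + y) k (addE_ge0 x0 y0)); apply: monophi.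
    apply: le_meet; first by apply: leE_add; exact: meetl.
    apply: leE_trans hk; rewrite scaler_nat mulr2n; apply: leE_add.
      by apply: leE_trans (meetr _ _) _; apply: wm; exact: leq_maxl.
    by apply: leE_trans (meetr _ _) _; apply: wm; exact: leq_maxr.
  - apply: subhomogeneous_eq => // a x; rewrite le_eqVlt => /predU1P[<- x0|a0 x0].
      apply: leh => m; rewrite mul0r scale0r -(lin0 lphi); apply: monophi; exact: meetl.
    have ai : 0 <= a^-1 by rewrite invr_ge0 ltW.
    apply: leh => m; have [k hk] := wc a^-1 m ai.
    apply: le_trans (ler_wpM2l (ltW a0) (hle x k x0)); rewrite -linZ//; apply: monophi.
    apply: (@leE_trans (meet (a *: x) (a *: (a^-1 *: w m)))).
      by rewrite scalerA mulfV ?gt_eqF// scale1r.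
    apply: leE_trans (scale_meet _ _ a0) _; apply: (bl_scale BL); first exact: ltW.
    exact: meet_mono.
exists f; split => // [x m x0|x c x0]; rewrite fh//; [exact: hle|exact: leh].
Qed.

Lemma order_continuous_disjoint_null (phi : E -> R) :
  dual_norm_order_continuous le -> dual_elt phi -> pos_lin phi -> disjoint_null phi.
Proof.
move=> oc dphi pphi v M v0 vM vd; have lphi := pphi.1.
have monophi := pos_lin_mono pphi.
pose V a b := \sum_(a <= k < b) v k.
have V0 a b : 0 <=E V a b by exact: sumE_ge0.
have Vcat a b c : (a <= b)%N -> (b <= c)%N -> V a c = V a b + V b c.
  by move=> ab bc; rewrite /V (@big_cat_nat _ _ _ b).
have Vd a b c : meet (V a b) (V b c) <=E 0.
  rewrite {1}/V big_nat; apply: disj_sum => // i /andP[_ ib].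
  rewrite meetC /V big_nat; apply: disj_sum => // j /andP[bj _].
  by rewrite meetC; apply: vd; exact: leq_trans ib bj.
(* The growing factor puts every multiple of [W N m] below a later [W N n], as
   [component_functional] demands. For [m <= N] the sum is empty and [W N m] is 0. *)
pose W N m := m.+1%:R *: V N m.
have W0 N m : 0 <=E W N m by apply: scaleE_ge0.
have Wz N m : (m < N)%N -> W N m = 0 by move=> mN; rewrite /W /V big_geq ?scaler0// ltnW.
have Wle N c n m : (N <= n)%N -> (n <= m)%N -> (c <= m.+1%:R :> R) -> c *: V N n <=E W N m.
  move=> Nn nm cm; apply: leE_trans (leE_scaler (V0 N n) cm) _.
  by apply: (bl_scale BL) => //; rewrite (Vcat _ _ _ Nn nm); exact: leE_addl.
have Wm N : {homo W N : m n / (m <= n)%N >-> m <=E n}.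
  move=> m n mn; have [Nm|Nm] := leqP N m.
    by apply: Wle => //; rewrite ler_nat.
  by rewrite Wz.
have Wc N (c : R) m : 0 <= c -> exists n, c *: W N m <=E W N n.
  move=> c0; have [Nm|Nm] := leqP N m; last first.
    by exists m; rewrite Wz// scaler0.
  have cm0 : 0 <= c * m.+1%:R by rewrite mulr_ge0.
  exists (m + Num.bound (c * m.+1%:R))%N; rewrite scalerA; apply: Wle => //.
    exact: leq_addr.
  apply: ltW; apply: lt_le_trans (archi_boundP cm0) _.
  by rewrite ler_nat; lia.
have [f hf] := choice (fun N => component_functional dphi pphi (W0 N) (@Wm N) (@Wc N)).
have df N : dual_elt (f N) by have [] := hf N.
have lef x N m : 0 <=E x -> phi (meet x (W N m)) <= f N x.
  by move=> x0; have [_ + _] := hf N; apply.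
have fle x N c : 0 <=E x -> (forall m, phi (meet x (W N m)) <= c) -> f N x <= c.
  by move=> x0; have [_ _] := hf N; apply.
(* Choose [N] so that [phi (meet x (W 0 N))] is within [e] of [f 0 x]. The tail from [N] on is
   disjoint from the terms before it, so its contribution adds to theirs inside [f 0 x] and [f N x]
   is at most [e]. *)
have f_to0 g : (forall N, dual_le le g (f N)) -> dual_le le g (fun=> 0).
  move=> gf x x0; apply/ler_addgt0Pr => e e0; rewrite add0r.
  have [N hN] : exists N, f 0%N x - e <= phi (meet x (W 0%N N)).
    apply: contrapT => nN; suff : f 0%N x <= f 0%N x - e by lra.
    apply: fle => // m; apply/ltW; rewrite ltNge; apply/negP => h; apply: nN; by exists m.
  apply: le_trans (gf N x x0) _; apply: fle => // m.
  pose n := maxn N m; have Nn : (N <= n)%N by exact: leq_maxl.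
  have mn : (m <= n)%N by exact: leq_maxr.
  pose A := n.+1%:R *: V 0%N N; pose B := n.+1%:R *: V N n.
  have A0 : 0 <=E A by apply: scaleE_ge0.
  have B0 : 0 <=E B by apply: scaleE_ge0.
  have AB : meet A B <=E 0.
    apply: leE_trans (scale_meet _ _ _) _ => //.
    by have := bl_scale BL (ler0n R n.+1) (Vd 0%N N n); rewrite scaler0.
  have ABW : A + B = W 0%N n by rewrite -scalerDr -Vcat.
  have h1 : phi (meet x (W 0%N N)) <= phi (meet x A).
    by apply: monophi; apply: meet_mono => //; apply: leE_scaler => //; rewrite ler_nat.
  have h2 : phi (meet x (W N m)) <= phi (meet x B).
    by apply: monophi; apply: meet_mono => //; exact: Wm.
  have := monophi _ _ (disj_meet_add x0 A0 B0 AB); rewrite ABW (linD lphi) => h3.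
  have := lef x 0%N n x0; lra.
have M0 : 0 <= M by apply: le_trans (vM 0%N).
have M1 : 0 < M + 1 by lra.
apply/cvgr0Pnorm_le => e e0.
have eM : 0 < e / (M + 1) by rewrite divr_gt0.
have anti i j : (i <= j)%N -> dual_le le (f j) (f i).
  move=> ij x x0; apply: fle => // m; apply: le_trans (lef x i m x0).
  apply: monophi; apply: meet_mono => //.
  have [jm|mj] := leqP j m; last by rewrite Wz.
  apply: (bl_scale BL) => //.
  by rewrite (Vcat _ _ _ ij jm) addrC; exact: leE_addl.
have f0 i : dual_le le (fun=> 0) (f i).
  by move=> x x0; apply: le_trans (lef x i 0%N x0); apply: pphi.2; exact: meet_ge0.
have [N hN] := oc nat (fun m n => (m <= n)%N) f leqnn
  (fun i j k ij jk => leq_trans ij jk) (ex_intro _ 0%N I)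
  (fun i j => ex_intro _ (maxn i j) (conj (leq_maxl i j) (leq_maxr i j)))
  df anti f0 (fun g _ => f_to0 g) _ eM.
exists N => // n /= Nn.
(* [W n n.+1] is [n.+2] times [v n], hence dominates [v n]. *)
have vn : phi (v n) <= f n (v n).
  apply: le_trans (lef (v n) n n.+1 (v0 n)); apply: monophi; apply: le_meet => //.
  rewrite /W /V big_nat1 -[X in X <=E _]scale1r; apply: leE_scaler => //.
  by rewrite ler1n.
rewrite ger0_norm; last exact: pphi.2.
apply: le_trans vn _.
(* Order continuity controls [f n] on the unit ball only, so [v n] is divided by [M + 1], which is
   positive even when [M] is 0; the bound [e / (M + 1)] compensates. *)
have M1i : 0 < (M + 1)^-1 by rewrite invr_gt0.
have : `|(M + 1)^-1 *: v n| <= 1.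
  rewrite normrZ gtr0_norm// ler_pdivrMl// mulr1.
  by apply: le_trans (vM n) _; lra.
move=> /(hN n Nn); rewrite (linZ (df n).1) normrM gtr0_norm// [X in _ <= X]mulrC.
by rewrite ler_pM2l//; apply: le_trans; exact: ler_norm.
Qed.

(** * Disjoint sequences are uaw-null; consequences for operators into l1 *)

Lemma disjoint_meet_sum (v : nat -> E) u K :
  (forall k, 0 <=E v k) -> (forall j k, (j < k)%N -> meet (v j) (v k) <=E 0) ->
  0 <=E u -> \sum_(k < K) meet u (v k) <=E meet u (\sum_(k < K) v k).
Proof.
move=> v0 vd u0; elim: K => [|K IH]; first by rewrite !big_ord0; exact: meet_ge0.
rewrite !big_ord_recr /=.
apply: leE_trans (leE_add IH (leE_refl _)) _; apply: disj_meet_add => //.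
  exact: sumE_ge0.
by apply: disj_sum => // i _; exact: vd.
Qed.

(** With [z k] the meet of [u] and [v k], a partial sum of the absolute values of [f (z k)] is [f]
    at a signed sum of the [z k]. By disjointness that signed sum has modulus below [u], so the
    series converges and its terms tend to 0. *)
Lemma disjoint_uaw_null (v : nat -> E) :
  (forall k, 0 <=E v k) -> (forall j k, (j < k)%N -> meet (v j) (v k) <=E 0) ->
  uaw_cvg0 le join v.
Proof.
move=> v0 vd u u0 f [lf cf].
have [C C0 hC] := dual_bounded lf cf.
pose z n := meet u (v n).
have z0 n : 0 <=E z n by exact: meet_ge0.
have -> : (fun n => f (meet (abs (v n - 0)) u)) = f \o z.
  by apply/funext => n /=; rewrite subr0 ge0_abs// meetC.
have sgz (F : nat -> R) K : (forall n, `|F n| <= 1) ->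
    abs (\sum_(n < K) F n *: z n) <=E \sum_(n < K) z n.
  move=> F1; elim: K => [|K IH]; first by rewrite !big_ord0 ge0_abs.
  rewrite !big_ord_recr/=; apply: leE_trans (abs_add _ _) _; apply: leE_add => //.
  have := F1 K; rewrite ler_norml => /andP[Fl Fu].
  apply: abs_le; rewrite -[X in _ <=E X]scale1r -?scaleNr; apply: leE_scaler => //; lra.
apply/norm_cvg0P; apply: cvg_series_cvg_0.
apply: nondecreasing_is_cvgn.
  by apply: nondecreasing_series => n _ _; exact: normr_ge0.
exists (C * `|u|) => _ [K _ <-]; rewrite /series /= big_mkord.
have -> : \sum_(k < K) `|f (z k)| = f (\sum_(k < K) Num.sg (f (z k)) *: z k).
  by rewrite lin_sum//; apply: eq_bigr => k _; rewrite linZ// -normrEsg.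
apply: le_trans (ler_norm _) _; apply: le_trans (hC _) _; apply: ler_wpM2l => //.
apply: norm_le_abs; apply: leE_trans (sgz (fun k => Num.sg (f (z k))) K _) _.
  by move=> n; rewrite normr_sg; case: (_ != 0).
apply: leE_trans (disjoint_meet_sum K v0 vd u0) _; exact: meetl.
Qed.

(** The hypothesis is applied to the rank-one operator that places [phi x] in coordinate 0, whose l1
    norm is the absolute value of [phi x]. *)
Lemma uaw_DP_disjoint_null (phi : E -> R) :
  (forall T : E -> nat -> R, positive_l1_operator le T -> uaw_DP le join T) ->
  dual_elt phi -> pos_lin phi -> disjoint_null phi.
Proof.
move=> DP [lphi cphi] pphi v M v0 vM vd.
have [C C0 hC] := dual_bounded lphi cphi.
pose T (x : E) (k : nat) : R := (k == 0)%:R * phi x.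
have Tser x : series (fun k => `|T x k|) @ \oo --> `|phi x|.
  apply: cvg_near_cst; near=> n.
  have n0 : (0 < n)%N by near: n; exact: nbhs_infty_gt.
  rewrite /series /= big_ltn// big1_seq ?addr0 /T ?eqxx ?mul1r// => k.
  by rewrite mem_index_iota => /andP[_ /andP[k0 _]]; rewrite gtn_eqF// mul0r normr0.
have nT x : l1norm (T x) = `|phi x| by exact: cvg_lim (Tser x).
have posT : positive_l1_operator le T.
  split; [split; [|split]|].
  - by move=> x; apply: cvgP (Tser x).
  - by move=> a x y; apply/funext => k; rewrite /T lphi; ring.
  - by exists C => x; rewrite nT.
  - by move=> x x0 k; rewrite mulr_ge0//; exact: pphi.2.
have := DP T posT v (ex_intro _ M vM) (disjoint_uaw_null v0 vd).
by under eq_fun do rewrite nT; move/norm_cvg0P.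
Unshelve. all: by end_near. Qed.

(** * From condition (D) back to both assertions *)

Lemma decreasing_net_inf (I : Type) (leI : I -> I -> Prop) (f : I -> E -> R) :
  (exists i : I, True) ->
  (forall i j, exists k, leI i k /\ leI j k) ->
  (forall i, dual_elt (f i)) ->
  (forall i j, leI i j -> dual_le le (f j) (f i)) ->
  (forall i, dual_le le (fun=> 0) (f i)) ->
  (forall g, dual_elt g -> (forall i, dual_le le g (f i)) -> dual_le le g (fun=> 0)) ->
  forall (u : E) (d : R), 0 <=E u -> 0 < d -> exists i, f i u <= d.
Proof.
move=> [i0 _] dir df anti f0 finf u d u0 d0.
have pf i : pos_lin (f i) by split; [exact: (df i).1|exact: f0].
(* Directedness makes the pointwise infimum additive on the cone, so it extends to a lower bound of
   the net in the dual. By [finf] this bound is at most 0 on the cone, which excludes [d <= h u]. *)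
pose h x := reals.inf [set f i x | i in [set: I]].
have hle x i : 0 <=E x -> h x <= f i x.
  by move=> x0; apply: ge_inf; [exists 0 => _ [j _ <-]; exact: f0|exists i].
have leh x c : (forall i, c <= f i x) -> c <= h x.
  by move=> hc; apply: lb_le_inf; [exists (f i0 x), i0|move=> _ [j _ <-]].
have h0 x : 0 <=E x -> 0 <= h x by move=> x0; apply: leh => i; exact: f0.
have [g [dg gh]] : exists g, dual_elt g /\ forall x, 0 <=E x -> g x = h x.
  apply: (@cone_extension h (f i0)) => //.
  - by move=> x x0; rewrite h0// hle.
  - move=> x y x0 y0; apply/eqP; rewrite eq_le; apply/andP; split; last first.
      apply: leh => i; rewrite (linD (df i).1); exact: lerD (hle x i x0) (hle y i y0).
    rewrite -lerBlDr; apply: (leh) => i; rewrite lerBlDr -lerBlDl.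
    apply: leh => j; rewrite lerBlDl; have [k [ik jk]] := dir i j.
    apply: le_trans (hle _ k (addE_ge0 x0 y0)) _.
    by rewrite (linD (df k).1) lerD// anti.
  - apply: subhomogeneous_eq => // a x; rewrite le_eqVlt => /predU1P[<- x0|a0 x0].
      rewrite mul0r scale0r; apply: le_trans (hle 0 i0 (leE_refl _)) _.
      by rewrite (lin0 (df i0).1).
    rewrite -ler_pdivrMl//; apply: leh => i; rewrite ler_pdivrMl// -(linZ (df i).1).
    by apply: hle; apply: scaleE_ge0 => //; exact: ltW.
apply: contrapT => nu.
have gf i : dual_le le g (f i) by move=> x x0; rewrite gh// hle.
have := finf g dg gf u u0; rewrite gh// => hu0.
have : d <= h u by apply: leh => i; rewrite leNgt; apply/negP => /ltW fi; apply: nu; exists i.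
lra.
Qed.

(** If the norms stay above [e], then for each [u] one goes past an index where the net is at most
    [e / 2] at [u]. A later [f i] exceeds [e] at some [x] of the unit ball, and [f i] with [abs x]
    is an escaping pair below [f i0]. *)
Lemma disjoint_null_order_continuous :
  (forall phi, dual_elt phi -> pos_lin phi -> disjoint_null phi) ->
  dual_norm_order_continuous le.
Proof.
move=> dn I leI f _ leIt ne dir df anti f0 finf e e0.
have pf i : pos_lin (f i) by split; [exact: (df i).1|exact: f0].
have [i0 _] := ne.
apply: contrapT => ni.
apply: (@disjoint_null_escape (f i0) 1 e e0 (dn _ (df i0) (pf i0))) => u u0.
have e2 : 0 < e / 2 by lra.
have [i1 hi1] := decreasing_net_inf ne dir df anti f0 finf u0 e2.
have [i2 [i02 i12]] := dir i0 i1.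
apply: contrapT => nx; apply: ni; exists i2 => i i2i x x1.
rewrite leNgt; apply/negP => /ltW efx; apply: nx.
exists (f i), (abs x); split => //; first exact/anti/(leIt _ _ _ i02).
- exact: abs_ge0.
- by rewrite norm_abs.
- split; first by apply: le_trans efx _; exact: pos_lin_abs.
  apply: le_trans hi1; apply: le_trans (anti _ _ (leIt _ _ _ i12 i2i) _ u0).
  by apply: pos_lin_mono => //; exact: meetr.
Qed.

(** The sum of coordinates [phi] satisfies [l1norm (T y) <= phi (abs y)]. If the norms do not tend
    to 0, some [abs (x n)] with [n] large escapes [u], with [phi] itself as the functional:
    uaw-nullity makes [phi] at most [e / 2] on the meet with [u]. *)
Lemma disjoint_null_uaw_DP (T : E -> nat -> R) :
  (forall phi, dual_elt phi -> pos_lin phi -> disjoint_null phi) ->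
  positive_l1_operator le T -> uaw_DP le join T.
Proof.
move=> dn [[Tl1 [Tlin [C TC]]] Tpos] x [M xM] xu.
have cT y : cvgn (series (T y)) by exact: normed_cvg (Tl1 y).
pose phi y := limn (series (T y)).
have lphi : linear_fun phi.
  move=> a y z; rewrite /phi Tlin.
  have -> : (fun k => a * T y k + T z k) = (a *: T y) + T z by [].
  rewrite lim_seriesD//; last exact: is_cvg_seriesZ.
  by rewrite lim_seriesZ.
have dphi : dual_elt phi.
  apply: (bounded_dual lphi) => y; apply: le_trans (TC y).
  exact: lim_series_norm (Tl1 y).
have lT k : linear_fun (T ^~ k) by move=> a y z; rewrite Tlin.
have pphi : pos_lin phi.
  split => // y y0; apply: limr_ge; first exact: cT.
  by near=> n; apply: sumr_ge0 => k _; exact: Tpos.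
have nle y : l1norm (T y) <= phi (abs y).
  apply: lim_series_le => // k; first exact: Tl1.
  by apply: (@pos_lin_abs (T ^~ k)); split => // z z0; exact: Tpos.
have n0 y : 0 <= l1norm (T y).
  by apply: limr_ge; [exact: Tl1|near=> n; apply: sumr_ge0].
apply/cvgr0Pnorm_le => e e0; apply: contrapT => ne.
apply: (@disjoint_null_escape phi M e e0 (dn _ dphi pphi)) => u u0.
have e2 : 0 < e / 2 by lra.
have /cvgr0Pnorm_le/(_ _ e2)[N _ hN] := xu u u0 phi dphi.
apply: contrapT => nx; apply: ne; exists N => // n Nn /=.
rewrite ger0_norm//; apply: le_trans (nle _) _.
rewrite leNgt; apply/negP => /ltW he; apply: nx.
exists phi, (abs (x n)); split => //.
- exact: abs_ge0.
- by rewrite norm_abs.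
- by split => //; apply: le_trans (ler_norm _) _; have := hN n Nn; rewrite subr0.
Unshelve. all: by end_near. Qed.

End VectorLattice.

Theorem theorem3p3 (R : realType) (E : completeNormedModType R)
  (le : E -> E -> Prop) (sup : E -> E -> E) :
  banach_lattice le sup ->
  ((forall T : E -> nat -> R, positive_l1_operator le T -> uaw_DP le sup T)
   <-> dual_norm_order_continuous le).
Proof.
move=> BL; split=> [DP|oc T].
  apply: (disjoint_null_order_continuous BL) => phi.
  exact: (uaw_DP_disjoint_null BL).
apply: (disjoint_null_uaw_DP BL) => phi.
exact: (order_continuous_disjoint_null BL).
Qed.
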